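(* Consider the gossip algorithm described in the context, under the standing assumptions stated there. Let $Z(k)=H\bar H\tilde x(k)$ and $\alpha_{k,\max}=\max_{i\in V}\alpha_{k,i}$. Then (i) $\sum_{k=0}^{\infty}\alpha_{k,\max}\|\tilde x(k)-Z(k)\|<\infty$ almost surely; (ii) $\sum_{k=0}^{\infty}\|\tilde x(k)-Z(k)\|^2<\infty$ almost surely.
   Context: Graphs and matrices. Let $V=\{1,\ldots,N\}$, $N\ge2$, and let $G_I=(V,E_I)$ (interference graph) be a connected undirected graph which is not complete, with adjacency matrix $A$; $B=A+I_N$. For $i\in V$: $N_I(i)$ is the neighbor set of $i$ in $G_I$, $\tilde N_I(i)=N_I(i)\cup\{i\}$, $m_i=\deg_{G_I}(i)+1$; $m=\sum_i m_i$. For $i,j\in V$: $s_{ij}=\sum_{l=1}^{j}B(i,l)+\sum_{r=1}^{i-1}m_r$; $E_j^i=e_{s_{ij}}\in\mathbb{R}^m$ if $j\in\tilde N_I(i)$, $E_j^i=\mathbf 0_m$ otherwise ($e_1,\dots,e_m$ standard basis of $\mathbb{R}^m$). $H=[\sum_iE_1^i,\ldots,\sum_iE_N^i]\in\mathbb{R}^{m\times N}$, $\bar H=\mathrm{diag}(1/m_1,\ldots,1/m_N)H^T$. The communication graph $G_C=(V,E_C)$ satisfies $G_m\subseteq G_C\subseteq G_I$ for a maximal triangle-free spanning subgraph $G_m$ of $G_I$ (triangle-free, spanning, and adding any edge of $G_I$ not in $G_m$ creates a triangle); $N_C(i)$ is the neighbor set of $i$ in $G_C$. $\mathrm{ind}(i,j)=\tilde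 N_I(i)\cap\tilde N_I(j)$ and $W_{ij}=I_m-\tfrac12\sum_{l\in\mathrm{ind}(i,j)}(E_l^i-E_l^j)(E_l^i-E_l^j)^T$. Game. Player $i$ has action set $\Omega_i\subset\mathbb{R}$, nonempty, compact and convex, and cost $J_i:\Omega^i\to\mathbb{R}$, $\Omega^i=\prod_{j\in\tilde N_I(i)}\Omega_j$, written $J_i(x_i,x_{-i}^i)$ with $x_{-i}^i\in\prod_{j\in N_I(i)}\Omega_j$; $J_i$ is continuously differentiable in $x_i$, jointly continuous in $x^i$, and convex in $x_i$ for every $x_{-i}^i$. $T_{\Omega_i}$ denotes Euclidean projection onto $\Omega_i$. Algorithm. The state is $\tilde x(k)\in\mathbb{R}^m$, whose entry at position $s_{ij}$ ($i\in V$, $j\in\tilde N_I(i)$) is $\tilde x_j^i(k)\in\Omega_j$, player $i$'s temporary estimate of player $j$'s action; the actions are $x_i(k)=\tilde x_i^i(k)$ and $x(k)=(x_1(k),\dots,x_N(k))$. Initial values $\tilde x^i(0)\in\Omega^i$ are arbitrary. At iteration $k$: $i_k$ is drawn uniformly from $V$ and $j_k$ uniformly from $N_C(i_k)$, independently of the past; $W(k)=W_{i_kj_k}$; $\bar x(k)=W(k)\tilde x(k)$; $\hat x_{-i}^i(k)=(\bar x_{s_{ij}}(k))_{j\in N_I(i)}$; for $i\in\{i_k,j_k\}$, $x_i(k+1)=T_{\Omega_i}[x_i(k)-\alpha_{k,i}\nabla_{x_i}J_i(x_i(k),\hat x_{-i}^i(k))]$, and $x_i(k+1)=x_i(k)$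 otherwise; then $\tilde x_j^i(k+1)=\bar x_{s_{ij}}(k)$ for $j\in N_I(i)$ and $\tilde x_i^i(k+1)=x_i(k+1)$. The step sizes are $\alpha_{k,i}=1/\nu_k(i)$, where $\nu_k(i)$ is the number of updates player $i$ has made up to time $k$; they satisfy $\sum_k\alpha_{k,i}^2<\infty$ and $\sum_k\alpha_{k,i}=\infty$ for all $i$.
   Formalization: ''Continuously differentiable in x_i'' is taken to mean that the partial gradient of J_i in x_i is jointly continuous on Ω^i; with continuity in x_i alone the gradient can be unbounded at an endpoint of Ω_i and claim (ii) can fail. *)

(* Defs.v *)
From HB Require Import structures.
From mathcomp Require Import all_boot all_order all_algebra.
From mathcomp Require Import all_classical all_reals all_analysis.
Set Implicit Arguments. Unset Strict Implicit. Unset Printing Implicit Defensive.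
Import Order.TTheory GRing.Theory Num.Theory.
Import numFieldNormedType.Exports.
Local Open Scope classical_set_scope.
Local Open Scope ring_scope.

Section Graphs.
Variable N : nat.

Definition simple_graph (G : rel 'I_N) := symmetric G /\ irreflexive G.
Definition connected_graph (G : rel 'I_N) := forall i j, connect G i j.
Definition complete_graph (G : rel 'I_N) := forall i j, i != j -> G i j.
Definition subgraph (G1 G2 : rel 'I_N) := forall i j, G1 i j -> G2 i j.
Definition triangle_free (G : rel 'I_N) :=
  forall a b c, ~~ [&& G a b, G b c & G c a].
Definition add_edge (G : rel 'I_N) (i j : 'I_N) : rel 'I_N :=
  fun a b => [|| G a b, (a == i) && (b == j) | (a == j) && (b == i)].
Definition max_triangle_free_spanning_subgraph (Gm G : rel 'I_N) :=
  [/\ simple_graph Gm, subgraph Gm G, triangle_free Gm &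
      forall i j, G i j -> ~~ Gm i j -> ~ triangle_free (add_edge Gm i j)].

Variable GI : rel 'I_N.

Definition NI (i : 'I_N) : {set 'I_N} := [set j | GI i j].
Definition tNI (i : 'I_N) : {set 'I_N} := [set j | (j == i) || GI i j].
Definition mi (i : 'I_N) : nat := #|NI i|.+1.
Definition mtot : nat := \sum_(i < N) mi i.
Definition Bn (i l : 'I_N) : nat := (GI i l : nat) + (i == l : nat).
(* s_{ij}; positions in R^m are 1-based in the paper, so the
   0-based index of s_{ij} is (sidx i j).-1 *)
Definition sidx (i j : 'I_N) : nat :=
  (\sum_(l < N | (l <= j)%N) Bn i l + \sum_(r < N | (r < i)%N) mi r)%N.

Variable R : realType.

Definition E (i j : 'I_N) : 'cV[R]_mtot :=
  if j \in tNI i then \col_a ((a : nat) == (sidx i j).-1)%:R else 0.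
Definition Hm : 'M[R]_(mtot, N) := \matrix_(a, l) \sum_(i < N) E i l a ord0.
Definition Hbar : 'M[R]_(N, mtot) :=
  diag_mx (\row_i ((mi i)%:R)^-1) *m Hm^T.
Definition Wm (i j : 'I_N) : 'M[R]_mtot :=
  1%:M - 2^-1 *: \sum_(l in tNI i :&: tNI j)
                    ((E i l - E j l) *m (E i l - E j l)^T).

Definition est (x : 'cV[R]_mtot) (i j : 'I_N) : R := ((E i j)^T *m x) ord0 ord0.

Definition enorm (x : 'cV[R]_mtot) : R := Num.sqrt (\sum_a (x a ord0) ^+ 2).

Definition in_Omega (Omega : 'I_N -> set R) (i : 'I_N) : set ('I_N -> R) :=
  [set y | forall j, j \in tNI i -> Omega j (y j)].
Definition upd (y : 'I_N -> R) (i : 'I_N) (t : R) : 'I_N -> R :=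
  fun j => if j == i then t else y j.
Definition local (i : 'I_N) (f : ('I_N -> R) -> R) :=
  forall y y', (forall j, j \in tNI i -> y j = y' j) -> f y = f y'.
(* continuity of f on the set A of profiles, R^N with its product
   (= Euclidean) topology *)
Definition cont_on (A : set ('I_N -> R)) (f : ('I_N -> R) -> R) :=
  {within (A : set {ptws 'I_N -> R}), continuous (f : {ptws 'I_N -> R} -> R)}.
Definition proj (S : set R) (x : R) : R :=
  xget 0 [set p | S p /\ forall q, S q -> `|x - p| <= `|x - q|].
Definition is_partial_grad (Omega : 'I_N -> set R) (i : 'I_N)
    (Ji : ('I_N -> R) -> R) (gi : ('I_N -> R) -> R) :=
  forall y, in_Omega Omega i y ->
    (fun t => (Ji (upd y i t) - Ji y) / (t - y i))
      @ within (Omega i) (dnbhs (y i)) --> gi y.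

Variables (Omega : 'I_N -> set R) (g : 'I_N -> ('I_N -> R) -> R).

Definition step (ij : 'I_N * 'I_N) (alpha : 'I_N -> R) (x : 'cV[R]_mtot)
  : 'cV[R]_mtot :=
  let xbar := Wm ij.1 ij.2 *m x in
  let xi i := est x i i in
  let xhat i := fun j => if j == i then xi i else est xbar i j in
  let xnext i := if (i == ij.1) || (i == ij.2)
                 then proj (Omega i) (xi i - alpha i * g i (xhat i))
                 else xi i in
  \sum_(i < N) \sum_(j in tNI i)
      (if j == i then xnext i else est xbar i j) *: E i j.

Variable sel : nat -> 'I_N * 'I_N.  (* realization of (i_k, j_k) *)

Definition nu (k : nat) (i : 'I_N) : nat :=
  \sum_(t < k.+1) (((sel t).1 == i) || ((sel t).2 == i) : nat).
Definition alpha (k : nat) (i : 'I_N) : R := ((nu k i)%:R)^-1.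
Definition alpha_max (k : nat) : R := \big[Num.max/0]_(i < N) alpha k i.

Fixpoint traj (x0 : 'cV[R]_mtot) (k : nat) : 'cV[R]_mtot :=
  match k with
  | 0 => x0
  | k'.+1 => step (sel k') (alpha k') (traj x0 k')
  end.

Definition Zt (x0 : 'cV[R]_mtot) (k : nat) : 'cV[R]_mtot :=
  Hm *m Hbar *m traj x0 k.

End Graphs.

Definition pdist (R : realType) (N : nat) (GC : rel 'I_N) (ij : 'I_N * 'I_N) : R :=
  (N%:R)^-1 * (if GC ij.1 ij.2 then ((#|[set j | GC ij.1 j]|)%:R)^-1 else 0).

Arguments traj {N} GI {R} Omega g sel x0 k.
Arguments Zt {N} GI {R} Omega g sel x0 k.
Arguments est {N} GI {R} x i j.
Arguments enorm {N} GI {R} x.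
Arguments alpha {N} R sel k i.
Arguments alpha_max {N} R sel k.

(* Main.v *)
(* The owner l of an action never averages its own copy, so the natural Lyapunov
   function is the squared distance of all estimates of x_l from the owner's
   value, summed over l.  Every follower of l is joined to l by a path of length
   at most two inside the closed neighbourhood of l in the communication graph
   (maximality of the triangle-free subgraph), hence one gossip exchange shrinks
   this function in mean by a fixed factor 1 - 1/(8 N^3).  A projected gradient
   step moves the owner's value by O(alpha), and player l is only charged at its
   own updates, where alpha runs through 1, 1/2, 1/3, ...; the total perturbation
   is therefore bounded deterministically.  Compensating for it gives a
   nonnegative supermartingale that dominates the partial sums of the Lyapunov
   function, which proves (ii); (i) follows by AM-GM. *)
Require Import Defs.
From HB Require Import structures.
From mathcomp Require Import all_boot all_order all_algebra.
From mathcomp Require Import all_classical all_reals all_analysis.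
From mathcomp Require Import measurable_realfun ring lra zify.
Set Implicit Arguments. Unset Strict Implicit. Unset Printing Implicit Defensive.
Import Order.TTheory GRing.Theory Num.Theory.
Import numFieldNormedType.Exports.
Local Open Scope classical_set_scope.
Local Open Scope ring_scope.

(** * Coordinates of the estimate space *)

Section Coordinates.
Variables (N : nat) (GI : rel 'I_N).
Hypothesis GI_simple : simple_graph GI.

Lemma in_tNI (i j : 'I_N) : (j \in tNI GI i) = (j == i) || GI i j.
Proof. by rewrite inE. Qed.

Lemma tNI_refl (i : 'I_N) : i \in tNI GI i.
Proof. by rewrite in_tNI eqxx. Qed.

Lemma tNI_sym (i j : 'I_N) : (j \in tNI GI i) = (i \in tNI GI j).
Proof. by rewrite !in_tNI eq_sym (GI_simple.1 i j). Qed.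

Lemma mi_tNI (i : 'I_N) : mi GI i = #|tNI GI i|.
Proof.
rewrite /mi.
have -> : tNI GI i = i |: NI GI i.
  by apply/setP => j; rewrite !inE.
by rewrite cardsU1 inE (GI_simple.2 i).
Qed.

Lemma Bn_tNI (i l : 'I_N) : Bn GI i l = (l \in tNI GI i).
Proof.
rewrite /Bn in_tNI eq_sym; case: eqP => [->|_]; first by rewrite (GI_simple.2 i).
by rewrite addn0.
Qed.

(** [Bn] is the 0/1 indicator of the closed neighbourhood, so the first sum in [sidx] is a rank
    inside [tNI GI i]. *)
Lemma sum_Bn_card (i j : 'I_N) :
  (\sum_(l < N | (l <= j)%N) Bn GI i l)%N
    = #|[set l in tNI GI i | (l <= j)%N]|.
Proof.
rewrite -sum1_card big_mkcond [RHS]big_mkcond /=; apply: eq_bigr => l _.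
by rewrite Bn_tNI !inE; case: (_ || _); case: leqP.
Qed.

(** In 1-based numbering, player [i] owns the block of positions from [offset i + 1] to
    [offset i + mi GI i]. *)
Definition offset (i : 'I_N) : nat := (\sum_(r < N | (r < i)%N) mi GI r)%N.

Lemma offset_lt (i i' : 'I_N) :
  (i < i')%N -> (offset i + mi GI i <= offset i')%N.
Proof.
move=> ii'; rewrite /offset [X in (_ <= X)%N](bigID (fun r : 'I_N => (r < i)%N)) /=.
apply: leq_add.
  apply: eq_leq; apply: eq_bigl => r.
  by case: (ltnP r i) => ri; rewrite ?andbF ?andbT // (ltn_trans ri ii').
by rewrite (bigD1 i) /= ?ii' ?ltnn // leq_addr.
Qed.

Lemma offset_mtot (i : 'I_N) : (offset i + mi GI i <= mtot GI)%N.
Proof.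
rewrite /offset /mtot [X in (_ <= X)%N](bigID (fun r : 'I_N => (r < i)%N)) /=.
by apply: leq_add => //; rewrite (bigD1 i) /= ?ltnn // leq_addr.
Qed.

Lemma sidx_gt (i j : 'I_N) : j \in tNI GI i -> (offset i < sidx GI i j)%N.
Proof.
move=> ij; rewrite /sidx sum_Bn_card -[X in (X < _)%N]add0n ltn_add2r.
by apply/card_gt0P; exists j; rewrite inE ij leqnn.
Qed.

Lemma sidx_le (i j : 'I_N) : (sidx GI i j <= offset i + mi GI i)%N.
Proof.
rewrite /sidx sum_Bn_card addnC leq_add2l mi_tNI; apply/subset_leq_card.
by apply/fintype.subsetP => l; rewrite inE => /andP[].
Qed.

Lemma sidx_mono (i j j' : 'I_N) :
  j' \in tNI GI i -> (j < j')%N -> (sidx GI i j < sidx GI i j')%N.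
Proof.
move=> ij' jj'; rewrite /sidx !sum_Bn_card ltn_add2r.
apply/proper_card/properP; split.
  apply/fintype.subsetP => l; rewrite !inE => /andP[-> lj] /=.
  exact: leq_trans lj (ltnW jj').
by exists j'; rewrite !inE -in_tNI ij' ?leqnn //= -ltnNge.
Qed.

Lemma sidx_inj (i j i' j' : 'I_N) : j \in tNI GI i -> j' \in tNI GI i' ->
  sidx GI i j = sidx GI i' j' -> (i, j) = (i', j').
Proof.
move=> ij ij' e.
have g := sidx_gt ij; have g' := sidx_gt ij'.
have l := sidx_le i j; have l' := sidx_le i' j'.
have ii' : i = i'.
  apply: val_inj; case: (ltngtP i i') => // /offset_lt h; lia.
subst i'; congr pair; apply: val_inj.
by case: (ltngtP j j') => // h; [have := sidx_mono ij' h|have := sidx_mono ij h];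
  rewrite e ltnn.
Qed.

Lemma sidx_ltn (i j : 'I_N) :
  j \in tNI GI i -> ((sidx GI i j).-1 < mtot GI)%N.
Proof.
move=> ij; have := sidx_gt ij; have := sidx_le i j; have := offset_mtot i; lia.
Qed.

Lemma mtot_gt0 (i : 'I_N) : (0 < mtot GI)%N.
Proof. by have := offset_mtot i; rewrite /mi; lia. Qed.

(** The 0-based position; its value is meaningful for [j] in [tNI GI i], where [val_pos] identifies
    it. *)
Definition pos (i j : 'I_N) : 'I_(mtot GI) :=
  insubd (Ordinal (mtot_gt0 i)) (sidx GI i j).-1.

Lemma val_pos (i j : 'I_N) : j \in tNI GI i -> pos i j = (sidx GI i j).-1 :> nat.
Proof. by move=> ij; rewrite val_insubd sidx_ltn. Qed.

Lemma pos_inj (i j i' j' : 'I_N) : j \in tNI GI i -> j' \in tNI GI i' ->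
  pos i j = pos i' j' -> (i, j) = (i', j').
Proof.
move=> ij ij' /(congr1 val) /=; rewrite !val_pos // => e.
apply: sidx_inj => //.
(* Both indices are positive, and [.-1] is injective only on positive numbers. *)
have := sidx_gt ij; have := sidx_gt ij'; lia.
Qed.

(** The pairs [(i, j)] with [j] in [tNI GI i] embed by [pos] and number exactly [mtot GI], so they
    exhaust the coordinates. *)
Lemma sum_pos (S : nmodType) (F : 'I_(mtot GI) -> S) :
  \sum_a F a = \sum_(i < N) \sum_(j in tNI GI i) F (pos i j).
Proof.
pose D : {set 'I_N * 'I_N} := finset (fun p => p.2 \in tNI GI p.1).
have inD p : (p \in D) = (p.2 \in tNI GI p.1) by rewrite /D finset.in_set.
have injD : {in D &, injective (fun p => pos p.1 p.2)}.
  by move=> [i j] [i' j']; rewrite !inD => /= ij ij' e; exact: (pos_inj ij ij' e).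
have cD : #|D| = mtot GI.
  rewrite /mtot -sum1_card (eq_bigl _ _ inD).
  rewrite -(pair_big_dep xpredT (fun i j => j \in tNI GI i) (fun _ _ => 1%N)) /=.
  by apply: eq_bigr => i _; rewrite sum1_card mi_tNI.
have imD : imset (fun p => pos p.1 p.2) (mem D) = @finset.setTfor 'I_(mtot GI).
  apply/eqP; rewrite eqEcard finset.subsetT card_in_imset // cD.
  by rewrite finset.cardsT card_ord /=.
rewrite (eq_bigl (fun a => a \in @finset.setTfor 'I_(mtot GI)));
  last by move=> a; rewrite finset.in_setT.
rewrite -imD big_imset //= pair_big_dep /=.
exact: eq_bigl.
Qed.

End Coordinates.

(** * The matrices of the algorithm read coordinate by coordinate *)

Section Estimates.
Variables (N : nat) (GI : rel 'I_N) (R : realType).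
Hypothesis GI_simple : simple_graph GI.
Implicit Types (x y : 'cV[R]_(mtot GI)) (i j l p q r : 'I_N).

Lemma E_delta i j : j \in tNI GI i -> E GI R i j = delta_mx (pos GI i j) ord0.
Proof.
move=> ij; rewrite /E ij; apply/matrixP => a b; rewrite !mxE ord1 eqxx andbT.
by rewrite -val_eqE /= val_pos.
Qed.

Lemma estE x i j : est GI x i j = \sum_a E GI R i j a ord0 * x a ord0.
Proof. by rewrite /est mxE; apply: eq_bigr => a _; rewrite mxE. Qed.

Lemma est_pos x i j : j \in tNI GI i -> est GI x i j = x (pos GI i j) ord0.
Proof.
move=> ij; rewrite estE E_delta // (bigD1 (pos GI i j)) //= big1 ?addr0.
  by rewrite mxE !eqxx mul1r.
by move=> a /negPf ap; rewrite mxE ap mul0r.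
Qed.

Lemma est_out x i j : j \notin tNI GI i -> est GI x i j = 0.
Proof.
move=> /negPf ij; rewrite estE big1 // => a _.
by rewrite /E ij mxE mul0r.
Qed.

Lemma estZ (c : R) x i j : est GI (c *: x) i j = c * est GI x i j.
Proof. by rewrite /est -scalemxAr mxE. Qed.

Lemma estB x y i j : est GI (x - y) i j = est GI x i j - est GI y i j.
Proof. by rewrite /est mulmxBr !mxE. Qed.

Lemma est_sum (I : Type) (s : seq I) (Q : pred I) (F : I -> 'cV[R]_(mtot GI)) i j :
  est GI (\sum_(k <- s | Q k) F k) i j = \sum_(k <- s | Q k) est GI (F k) i j.
Proof. by rewrite /est mulmx_sumr summxE. Qed.

Lemma est_E p l i j : l \in tNI GI p -> j \in tNI GI i ->
  est GI (E GI R p l) i j = ((p == i) && (l == j))%:R.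
Proof.
move=> pl ij; rewrite est_pos // E_delta // mxE eqxx andbT.
congr (nat_of_bool _)%:R; apply/eqP/andP => [/(pos_inj GI_simple ij pl) [-> ->] //|].
by move=> [/eqP -> /eqP ->].
Qed.

Lemma sum_sq_est x : \sum_a x a ord0 ^+ 2
  = \sum_i \sum_(j in tNI GI i) est GI x i j ^+ 2.
Proof.
rewrite (sum_pos GI_simple); apply: eq_bigr => i _; apply: eq_bigr => j ij.
by rewrite est_pos.
Qed.

(** Each rank-one term, with its factor 1/2, replaces the two copies of one common index by their
    mean, and distinct indices touch disjoint coordinates. For [p = q] every term vanishes, in
    agreement with the mean of two equal values. *)
Lemma est_Wm p q x i j : j \in tNI GI i ->
  est GI (Wm GI R p q *m x) i j =
  if (j \in tNI GI p) && (j \in tNI GI q) && ((i == p) || (i == q))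
  then (est GI x p j + est GI x q j) / 2 else est GI x i j.
Proof.
move=> ij.
have dT l : (E GI R p l - E GI R q l)^T *m x
    = (est GI x p l - est GI x q l)%:M.
  rewrite [LHS]mx11_scalar; congr (_%:M).
  by rewrite linearB /= mulmxBl /est !mxE.
have -> : est GI (Wm GI R p q *m x) i j = est GI x i j - 2^-1 *
   \sum_(l in tNI GI p :&: tNI GI q) (est GI x p l - est GI x q l)
     * (((p == i) && (l == j))%:R - ((q == i) && (l == j))%:R).
  rewrite /Wm mulmxBl mul1mx estB; congr (_ - _).
  rewrite -scalemxAl estZ mulmx_suml est_sum; congr (_ * _).
  apply: eq_bigr => l; rewrite finset.inE => /andP[pl ql].
  by rewrite -mulmxA dT mul_mx_scalar estZ estB !est_E.
have [|nind] := boolP ((j \in tNI GI p) && (j \in tNI GI q)).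
  rewrite -finset.in_setI => jind.
  rewrite (bigD1 j) //= big1 ?addr0; last first.
    by move=> l /andP[_ /negPf ->]; rewrite !andbF subrr mulr0.
  rewrite eqxx !andbT ![_ == i]eq_sym.
  case: (eqVneq i p) => [->|_] /=.
    by case: (eqVneq p q) => [->|_]; rewrite /=; field.
  by case: (eqVneq i q) => [->|_]; rewrite /=; field.
rewrite /= big1 ?mulr0 ?subr0 // => l; rewrite finset.in_setI => lind.
case: (eqVneq l j) => [lj|]; last by rewrite !andbF subrr mulr0.
by rewrite -lj lind in nind.
Qed.

(** Column [l] of [Hm] marks all copies of the action of [l], and [Hbar] divides by their number, so
    every copy becomes their mean. *)
Lemma est_HHbar x i l : l \in tNI GI i ->
  est GI (Hm GI R *m Hbar GI R *m x) i l
    = (#|tNI GI l|%:R)^-1 * \sum_(r in tNI GI l) est GI x r l.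
Proof.
move=> il; rewrite -mulmxA est_pos // mxE (bigD1 l) //= big1 ?addr0.
  rewrite mxE (bigD1 i) //= big1 ?addr0; last first.
    move=> r /negPf ri; rewrite -est_pos //.
    have [rl|rl] := boolP (l \in tNI GI r); first by rewrite est_E // ri.
    by rewrite est_pos // /E (negPf rl) mxE.
  rewrite -est_pos // est_E // !eqxx mul1r /Hbar -mulmxA mul_diag_mx !mxE.
  rewrite mi_tNI //; congr (_ * _).
  under [LHS]eq_bigr do rewrite 2!mxE mulr_suml.
  rewrite exchange_big [RHS]big_mkcond /=; apply: eq_bigr => r _.
  rewrite -estE (tNI_sym GI_simple); case: ifP => // /negbT; exact: est_out.
move=> k kl; rewrite mxE big1 ?mul0r // => r _.
rewrite -est_pos //; have [rk|rk] := boolP (k \in tNI GI r).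
  by rewrite est_E // (negPf kl) andbF.
by rewrite est_pos // /E (negPf rk) mxE.
Qed.

(** The player's own action is read before the exchange, although [Wm] may average that coordinate
    too. *)
Definition gradient_point (c : 'I_N * 'I_N)
    (x : 'cV[R]_(mtot GI)) (i j : 'I_N) : R :=
  if j == i then est GI x i i else est GI (Wm GI R c.1 c.2 *m x) i j.

Definition next_action (Omega : 'I_N -> set R) (g : 'I_N -> ('I_N -> R) -> R)
    (c : 'I_N * 'I_N) (al : 'I_N -> R) (x : 'cV[R]_(mtot GI)) (i : 'I_N) : R :=
  if (i == c.1) || (i == c.2)
  then Defs.proj (Omega i) (est GI x i i - al i * g i (gradient_point c x i))
  else est GI x i i.

Lemma est_step Omega g c (al : 'I_N -> R) x i j : j \in tNI GI i ->
  est GI (step Omega g c al x) i j =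
  if j == i then next_action Omega g c al x i
  else est GI (Wm GI R c.1 c.2 *m x) i j.
Proof.
move=> ij; rewrite /step est_sum (bigD1 i) //= [X in _ + X]big1 ?addr0; last first.
  move=> r /negPf ri; rewrite est_sum big1 // => k kr.
  by rewrite estZ est_E // ri mulr0.
rewrite est_sum (bigD1 j) //= [X in _ + X]big1 ?addr0; last first.
  by move=> k /andP[ki /negPf kj]; rewrite estZ est_E // kj andbF mulr0.
by rewrite estZ est_E // !eqxx mulr1.
Qed.

End Estimates.

(** * Mean contraction of a gossip exchange *)

Section Contraction.
Variables (N : nat) (R : realType).
Implicit Types (i j l p q : 'I_N) (S : {set 'I_N}) (u : 'I_N -> R).

(** By maximality, adding the edge [i l] creates a triangle; it must use the new edge, and its third
    vertex is the required [c]. *)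
Lemma max_triangle_free_two_step (Gm GI : rel 'I_N) i l :
  simple_graph GI -> max_triangle_free_spanning_subgraph Gm GI ->
  GI i l -> ~~ Gm i l -> exists2 c, Gm i c & Gm c l.
Proof.
move=> [_ irrI] [[symm irrm] _ tf max] il nil.
have neq_il : i != l by apply: contraTneq il => ->; rewrite irrI.
(* The definition of a triangle does not ask for distinct vertices; irreflexivity rules out a third
   vertex equal to an endpoint of the new edge. *)
have close x y c : x != y -> (x, y) = (i, l) \/ (x, y) = (l, i) ->
    add_edge Gm i l y c -> add_edge Gm i l c x -> Gm x c && Gm c y.
  move=> xy exy; rewrite /add_edge.
  have [cx|cx] := eqVneq c x.
    rewrite cx irrm => _ /orP[|/orP[|]] // /andP[/eqP e1 /eqP e2];
    by case: exy => -[h1 h2]; move: xy; rewrite -?h1 -?h2 in e1 e2 *;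
      rewrite ?e1 ?e2 ?eqxx // -?e1 -?e2 ?eqxx.
  have [cy|cy] := eqVneq c y.
    rewrite cy irrm => /orP[|/orP[|]] // /andP[/eqP e1 /eqP e2];
    by case: exy => -[h1 h2]; move: xy; rewrite -?h1 -?h2 in e1 e2 *;
      rewrite ?e1 ?e2 ?eqxx // -?e1 -?e2 ?eqxx.
  case: exy => -[<- <-]; rewrite (negPf cx) (negPf cy) !andbF !orbF /=
    => yc cx'; by rewrite symm cx' symm yc.
have := max i l il nil; rewrite /triangle_free => h.
have [a [b [c /and3P[ab bc ca]]]] :
    exists a b c, [&& add_edge Gm i l a b, add_edge Gm i l b c & add_edge Gm i l c a].
  apply: contrapT => hn; apply: h => a b c; apply/negP => habc.
  by apply: hn; exists a, b, c.
(* Rotate the triangle so that an edge outside [Gm] comes first; triangle-freeness of [Gm] provides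
   one. *)
suff [x [y [z [exy yz zx]]]] : exists x y z, [/\ (x, y) = (i, l) \/ (x, y) = (l, i),
    add_edge Gm i l y z & add_edge Gm i l z x].
  have xy : x != y by case: exy => -[-> ->] //; rewrite eq_sym.
  have /andP[xz zy] := close x y z xy exy yz zx.
  case: exy => -[ex ey]; exists z; rewrite -?ex -?ey //.
    by rewrite symm.
  by rewrite symm.
have new x y : add_edge Gm i l x y -> ~~ Gm x y ->
    (x, y) = (i, l) \/ (x, y) = (l, i).
  rewrite /add_edge => /orP[->//|/orP[|] /andP[/eqP -> /eqP ->]]; by [left|right].
have [gab|gab] := boolP (Gm a b); last by exists a, b, c; split => //; exact: new.
have [gbc|gbc] := boolP (Gm b c); last by exists b, c, a; split => //; exact: new.
have [gca|gca] := boolP (Gm c a); last by exists c, a, b; split => //; exact: new.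
by have := tf a b c; rewrite gab gbc gca.
Qed.

(** Here [u] is the deviation from the value held by the owner [l]. The owner enters the average
    with deviation 0 but keeps its own copy, hence the first branch. *)
Definition average_followers S l p q u i : R :=
  if i == l then 0
  else if [&& p \in S, q \in S & (i == p) || (i == q)] then (u p + u q) / 2
  else u i.

(** For two distinct followers this is the parallelogram identity, with equality. If one partner is
    the owner, the other's deviation is halved and three quarters of its square is lost, more than
    the half required. *)
Lemma average_followers_decrease S l p q u : u l = 0 ->
  \sum_(i in S) average_followers S l p q u i ^+ 2
    + (if (p \in S) && (q \in S) then (u p - u q) ^+ 2 / 2 else 0)
  <= \sum_(i in S) u i ^+ 2.
Proof.
move=> ul0.
have rest (Q : pred 'I_N) : (forall i, Q i -> i != p /\ i != q) ->
    \sum_(i in S | Q i) average_followers S l p q u i ^+ 2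
      = \sum_(i in S | Q i) u i ^+ 2.
  move=> hQ; apply: eq_bigr => i /andP[_ /hQ [/negPf ip /negPf iq]].
  rewrite /average_followers ip iq !andbF /=.
  by case: eqP => [->|//]; rewrite ul0.
have [/andP[pS qS]|npq] := boolP ((p \in S) && (q \in S)); last first.
  rewrite addr0 le_eqVlt; apply/orP; left; apply/eqP; apply: eq_bigr => i _.
  rewrite /average_followers andbA (negPf npq) /=.
  by case: eqP => [->|//]; rewrite ul0.
have [pq|pq] := eqVneq p q.
  subst q; rewrite subrr expr0n mul0r addr0.
  rewrite le_eqVlt; apply/orP; left; apply/eqP; apply: eq_bigr => i _.
  rewrite /average_followers pS orbb /=; case: eqP => [->|_]; first by rewrite ul0.
  by case: eqP => [->|//]; congr (_ ^+ 2); field.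
rewrite (bigD1 p) // [in leRHS](bigD1 p) //=.
rewrite (bigD1 q) ?qS 1?eq_sym //= [in leRHS](bigD1 q) ?qS 1?eq_sym //=.
under eq_bigl do rewrite -andbA.
under [in leRHS]eq_bigl do rewrite -andbA.
rewrite (rest (fun i => (i != p) && (i != q))); last by move=> i /andP[].
rewrite /average_followers pS qS !eqxx !orbT /=.
set r := \sum_(_ | _) _.
have [pl|pl] := eqVneq p l; have [ql|ql] := eqVneq q l.
- by rewrite pl ql eqxx in pq.
- by rewrite pl ul0; have := sqr_ge0 (u q); lra.
- by rewrite ql ul0; have := sqr_ge0 (u p); lra.
- by rewrite le_eqVlt; apply/orP; left; apply/eqP; field.
Qed.

Variables (GI GC Gm : rel 'I_N).
Hypothesis GI_simple : simple_graph GI.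
Hypotheses (Gm_max : max_triangle_free_spanning_subgraph Gm GI)
  (Gm_GC : subgraph Gm GC).

Lemma pdist_ge0 (c : 'I_N * 'I_N) : 0 <= pdist R GC c.
Proof.
by rewrite /pdist mulr_ge0 ?invr_ge0 ?ler0n //; case: ifP => _; rewrite ?invr_ge0.
Qed.

(** Players without a neighbour in [GC] contribute zero, so the mass is only bounded by one; the
    supermartingale argument asks for no more. *)
Lemma pdist_sum_le1 : \sum_c pdist R GC c <= 1.
Proof.
rewrite -(pair_bigA _ (fun i j => pdist R GC (i, j))) /pdist /=.
have row i : \sum_j (N%:R^-1 * (if GC i j then (#|[set j | GC i j]|%:R)^-1 else 0))
    <= N%:R^-1 :> R.
  rewrite -mulr_sumr -[leRHS]mulr1 ler_wpM2l ?invr_ge0 //.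
  rewrite -big_mkcond /= sumr_const.
  have -> : #|[pred j | GC i j]| = #|[set j | GC i j]|.
    by apply: eq_card => j; rewrite inE; apply/idP/idP => [/mem_set|/set_mem].
  rewrite -[X in X *+ _]mul1r -mulrnAr -mulr_natl mul1r.
  by case: #|_| => [|n]; rewrite ?mul0r ?ler01 // divff // pnatr_eq0.
apply: (@le_trans _ _ (\sum_(i < N) N%:R^-1)).
  by apply: ler_sum => i _; exact: row.
rewrite sumr_const card_ord -[leLHS]mulr_natl.
by have [->|n0] := posnP N; rewrite ?mul0r ?ler01 // divff // pnatr_eq0 -lt0n.
Qed.

Lemma pdist_edge_ge i j : GC i j -> (N%:R ^+ 2)^-1 <= pdist R GC (i, j).
Proof.
move=> gij; rewrite /pdist /= gij expr2 invfM ler_wpM2l ?invr_ge0 //.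
have deg0 : (0 < #|[set j | GC i j]|)%N.
  by apply/card_gt0P; exists j; exact: mem_set.
have N0 : (0 < N)%N by apply: leq_ltn_trans (ltn_ord i).
rewrite lef_pV2 ?posrE ?ltr0n // ler_nat.
by rewrite -[X in (_ <= X)%N]card_ord max_card.
Qed.

Definition edge_energy S u (c : 'I_N * 'I_N) : R :=
  if (c.1 \in S) && (c.2 \in S) then (u c.1 - u c.2) ^+ 2 / 2 else 0.

Lemma edge_energy_ge0 S u c : 0 <= edge_energy S u c.
Proof. by rewrite /edge_energy; case: ifP => // _; rewrite divr_ge0 ?sqr_ge0. Qed.

(** A follower reaches the owner in at most two edges of [Gm]. The middle vertex is a neighbour of
    [l] in [GI], so both edges are counted in the mean energy, each with probability at least
    [1 / N ^ 2]. *)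
Lemma follower_gap_le l u i : u l = 0 -> i \in tNI GI l ->
  u i ^+ 2 <= 8 * N%:R ^+ 2 *
     \sum_c pdist R GC c * edge_energy (tNI GI l) u c.
Proof.
move=> ul0 il; set Ed := \sum_c _.
have Ed0 : 0 <= Ed.
  by apply: sumr_ge0 => c _; rewrite mulr_ge0 ?pdist_ge0 ?edge_energy_ge0.
have N0 : 0 < N%:R ^+ 2 :> R.
  by rewrite exprn_gt0 // ltr0n; apply: leq_ltn_trans (ltn_ord i).
have edge p q : p \in tNI GI l -> q \in tNI GI l -> GC p q ->
    (u p - u q) ^+ 2 <= 2 * (N%:R ^+ 2 * Ed).
  move=> pl ql pq.
  have h : (N%:R ^+ 2)^-1 * ((u p - u q) ^+ 2 / 2) <= Ed.
    apply: (@le_trans _ _ (pdist R GC (p, q) * edge_energy (tNI GI l) u (p, q))).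
      rewrite /edge_energy /= pl ql ler_wpM2r ?pdist_edge_ge //.
      by rewrite divr_ge0 ?sqr_ge0.
    rewrite /Ed (bigD1 (p, q)) //= lerDl.
    by apply: sumr_ge0 => c _; rewrite mulr_ge0 ?pdist_ge0 ?edge_energy_ge0.
  by move: h; rewrite ler_pdivrMl // => h; lra.
have [->|neq_il] := eqVneq i l.
  by rewrite ul0 expr0n /= mulr_ge0 // mulr_ge0 // ltW.
have ll := tNI_refl GI l.
have NEd : 0 <= N%:R ^+ 2 * Ed by rewrite mulr_ge0 // ltW.
have [gil|ngil] := boolP (Gm i l).
  have := edge _ _ il ll (Gm_GC gil); rewrite ul0 subr0 => h.
  by rewrite -mulrA; lra.
have GIil : GI i l.
  by move: il; rewrite in_tNI (negPf neq_il) /= (GI_simple.1 l i).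
have [c ic cl] := max_triangle_free_two_step GI_simple Gm_max GIil ngil.
have cS : c \in tNI GI l.
  rewrite in_tNI (GI_simple.1 l c); case: Gm_max => _ sub _ _.
  by rewrite (sub _ _ cl) orbT.
have h1 := edge _ _ il cS (Gm_GC ic).
have h2 := edge _ _ cS ll (Gm_GC cl).
rewrite ul0 subr0 in h2; rewrite -mulrA.
(* This square is [2 (u i - u c)^2 + 2 (u c)^2 - (u i)^2]; the two edge bounds then add up to the
   constant 8. *)
have : 0 <= (u i - 2 * u c) ^+ 2 by exact: sqr_ge0.
nra.
Qed.

(** The factor [8 N ^ 2] of [follower_gap_le], summed over at most [N] followers. *)
Definition gossip_rate : R := (8 * N%:R ^+ 3)^-1.

Lemma followers_contraction l u : u l = 0 ->
  \sum_c pdist R GC c *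
    (\sum_(i in tNI GI l) average_followers (tNI GI l) l c.1 c.2 u i ^+ 2)
  <= (1 - gossip_rate) * \sum_(i in tNI GI l) u i ^+ 2.
Proof.
move=> ul0; set S := tNI GI l; set V := \sum_(i in S) u i ^+ 2.
set Ed := \sum_c pdist R GC c * edge_energy S u c.
have V0 : 0 <= V by apply: sumr_ge0 => i _; exact: sqr_ge0.
have N0 : 0 < N%:R :> R by rewrite ltr0n; apply: leq_ltn_trans (ltn_ord l).
have N3 : 0 < 8 * N%:R ^+ 3 :> R by rewrite mulr_gt0 ?exprn_gt0.
have Ed0 : 0 <= Ed.
  by apply: sumr_ge0 => c _; rewrite mulr_ge0 ?pdist_ge0 ?edge_energy_ge0.
have VEd : V <= 8 * N%:R ^+ 3 * Ed.
  apply: (@le_trans _ _ (\sum_(i in S) 8 * N%:R ^+ 2 * Ed)).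
    by apply: ler_sum => i iS; exact: follower_gap_le.
  rewrite sumr_const -[leLHS]mulr_natl.
  have -> : 8 * N%:R ^+ 3 * Ed = N%:R * (8 * N%:R ^+ 2 * Ed) by ring.
  rewrite ler_wpM2r ?ler_nat ?mulr_ge0 ?exprn_ge0 ?ler0n //.
  by rewrite -[X in (_ <= X)%N]card_ord max_card.
have VEd' : gossip_rate * V <= Ed by rewrite /gossip_rate ler_pdivrMl.
apply: (@le_trans _ _ (\sum_c pdist R GC c * (V - edge_energy S u c))).
  apply: ler_sum => c _; rewrite ler_wpM2l ?pdist_ge0 // lerBrDr.
  exact: average_followers_decrease.
under eq_bigr do rewrite mulrBr.
rewrite sumrB -mulr_suml -/Ed mulrBl mul1r lerB //.
by rewrite -[leRHS]mul1r ler_wpM2r ?pdist_sum_le1.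
Qed.

End Contraction.

(** * One step of the algorithm *)

Section RealSets.
Variable R : realType.

Lemma convex_midpoint (A : set R) (x y : R) :
  convex_set A -> A x -> A y -> A ((x + y) / 2).
Proof.
move=> cA Ax Ay.
have h0 : (0 : R) <= 2^-1 by [].
have h1 : (2^-1 : R) <= 1 by rewrite invf_le1 // ler1n.
have := cA x y (Itv01 h0 h1) (mem_set Ax) (mem_set Ay).
move=> /set_mem; congr A.
rewrite /conv /= /GRing.scale /=.
by rewrite /unstable.onem; field.
Qed.

Lemma proj_closest (A : set R) (x : R) : A !=set0 -> compact A ->
  A (Defs.proj A x) /\ forall q, A q -> `|x - Defs.proj A x| <= `|x - q|.
Proof.
move=> A0 cA.
have cf : {within A, continuous (fun p : R => `|x - p|)}.
  apply: continuous_subspaceT => p.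
  by apply: cvg_norm; apply: cvgB; [exact: cvg_cst|exact: cvg_id].
have [c cin cmin] := compact_EVT_min A0 cA cf.
rewrite /Defs.proj.
apply: (@xgetPex _ 0 [set p | A p /\ forall q, A q -> `|x - p| <= `|x - q|]).
exists c; split; first exact: set_mem.
by move=> q Aq; apply: cmin; exact: mem_set.
Qed.

(** The point [x] competes in the minimisation, so the projection is within [|t|] of [x - t], which
    is itself at distance [|t|] from [x]. *)
Lemma proj_move (A : set R) (x t : R) : compact A -> A x ->
  `|Defs.proj A (x - t) - x| <= 2 * `|t|.
Proof.
move=> cA Ax; have [_ /(_ x Ax)] := proj_closest (x - t) (ex_intro _ x Ax) cA.
have -> : x - t - x = - t by ring.
rewrite normrN => h.
have -> : Defs.proj A (x - t) - x
    = - (x - t - Defs.proj A (x - t)) - t by ring.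
by rewrite (le_trans (ler_normB _ _)) // normrN; lra.
Qed.

(** The mean minimises the sum of squared deviations: expanding around it, the cross term
    vanishes. *)
Lemma variance_le (I : finType) (S : {set I}) (a : I -> R) (t : R) :
  \sum_(i in S) (a i - #|S|%:R^-1 * \sum_(j in S) a j) ^+ 2
    <= \sum_(i in S) (a i - t) ^+ 2.
Proof.
set mu := _ * _.
have [S0|S0] := posnP #|S|.
  by rewrite !(eq_bigl _ _ (card0_eq S0)) !big_pred0_eq.
have muE : \sum_(i in S) (a i - mu) = 0.
  rewrite sumrB sumr_const -[X in _ - X]mulr_natl /mu mulVKf ?subrr //.
  by rewrite pnatr_eq0 -lt0n.
have -> : \sum_(i in S) (a i - t) ^+ 2 = \sum_(i in S) (a i - mu) ^+ 2
    + 2 * (mu - t) * \sum_(i in S) (a i - mu) + \sum_(i in S) (mu - t) ^+ 2.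
  by rewrite mulr_sumr -!big_split /=; apply: eq_bigr => i _; ring.
rewrite muE mulr0 addr0 lerDl; apply: sumr_ge0 => i _; exact: sqr_ge0.
Qed.

Lemma sqr_sub_le (e a b : R) : 0 < e ->
  (a - b) ^+ 2 <= (1 + e) * a ^+ 2 + (1 + e^-1) * b ^+ 2.
Proof.
move=> e0; rewrite -subr_ge0.
have -> : (1 + e) * a ^+ 2 + (1 + e^-1) * b ^+ 2 - (a - b) ^+ 2
    = e^-1 * (e * a + b) ^+ 2 by field; rewrite gt_eqF.
by rewrite mulr_ge0 ?sqr_ge0 // invr_ge0 ltW.
Qed.

End RealSets.

(** * Total squared step size *)

Section Noise.
Variables (N : nat) (R : realType).

Definition updated (c : 'I_N * 'I_N) (i : 'I_N) : bool := (i == c.1) || (i == c.2).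

Definition noise (c : 'I_N * 'I_N) (al : 'I_N -> R) : R :=
  \sum_i (if updated c i then al i ^+ 2 else 0).

(* Only the steps at which a player actually updates are charged, and along
   those the step sizes are 1, 1/2, 1/3, ... *)
Lemma sum_noise_le (a : nat -> 'I_N * 'I_N) n :
  \sum_(k < n) noise (a k) (alpha R a k) <= 2 * N%:R.
Proof.
rewrite /noise exchange_big /= -[X in _ <= _ * X%:R]card_ord mulr_natr -sumr_const.
apply: ler_sum => i _.
pose cnt m := (\sum_(t < m) (((a t).1 == i) || ((a t).2 == i) : nat))%N.
(* Telescoping bound: if [c] updates came before, the next one adds [1 / (c + 1)^2], at most
   [2 / (c + 1) - 2 / (c + 2)]. *)
suff h m : \sum_(k < m) (if updated (a k) i then alpha R a k i ^+ 2 else 0)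
    <= 2 - 2 / (cnt m).+1%:R.
  by apply: le_trans (h n) _; rewrite lerBlDr lerDl divr_ge0.
elim: m => [|m IH]; first by rewrite big_ord0 /cnt big_ord0 divr1 subrr.
rewrite big_ord_recr /=; apply: le_trans (lerD IH (lexx _)) _.
rewrite /alpha /nu -/(cnt m.+1).
have -> : cnt m.+1 = (cnt m + (updated (a m) i : nat))%N.
  by rewrite /cnt big_ord_recr /= /updated ![_ == i]eq_sym.
case: (updated (a m) i); last by rewrite addn0 addr0.
rewrite addn1; set c := cnt m; rewrite -[c.+2%:R]natr1 -[c.+1%:R]natr1; set z : R := c%:R.
have z0 : 0 <= z by rewrite ler0n.
have -> : 2 - 2 / (z + 1 + 1) = 2 - 2 / (z + 1) + 2 / ((z + 1) * (z + 1 + 1)).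
  by field; rewrite ?gt_eqF //; lra.
have z1 : 0 < z + 1 by lra.
have z2 : 0 < z + 1 + 1 by lra.
rewrite lerD2l exprVn ler_pdivlMr ?mulr_gt0 // ler_pdivrMl ?exprn_gt0 //.
rewrite -subr_ge0 (_ : _ - _ = z * (z + 1)); last by ring.
by rewrite mulr_ge0 // ltW.
Qed.

End Noise.

(** * Bounded gradients and the one-step inequality *)

Section Descent.
Variables (N : nat) (GI : rel 'I_N) (R : realType).
Variables (Omega : 'I_N -> set R) (g : 'I_N -> ('I_N -> R) -> R).
Hypothesis GI_simple : simple_graph GI.
Hypothesis Omega_ok :
  forall i, [/\ Omega i !=set0, compact (Omega i) & convex_set (Omega i)].

(** The product of all action sets is compact by Tychonoff, so each continuous [g i] is bounded on
    it; the sum of these bounds serves all players. *)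
Lemma gradient_bounded :
  (forall i, local GI i (g i)) -> (forall i, cont_on (in_Omega GI Omega i) (g i)) ->
  exists2 K : R, 0 <= K & forall i y, in_Omega GI Omega i y -> `|g i y| <= K.
Proof.
move=> gloc gcont.
pose cube : set {ptws 'I_N -> R} := [set f | forall i, Omega i (f i)].
have cube_compact : compact cube.
  by apply: (@tychonoff _ (fun=> R) Omega) => i; case: (Omega_ok i).
have bnd i : {K : R | 0 <= K & forall y, in_Omega GI Omega i y -> `|g i y| <= K}.
  apply: cid2.
  have cg : {within cube, continuous (g i : {ptws 'I_N -> R} -> R)}.
    by apply: continuous_subspaceW (gcont i) => y yc j _; exact: yc.
  have [M [_ hM]] := compact_bounded (continuous_compact cg cube_compact).
  exists (`|M| + 1); first by rewrite addr_ge0.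
  (* By locality, the coordinates that [g i] does not read can be refilled from [Omega], which puts
     the profile in the cube without changing the value. *)
  move=> y yO; pose y' j := if j \in tNI GI i then y j else xget 0 (Omega j).
  have -> : g i y = g i y' by apply: gloc => j ji; rewrite /y' ji.
  have M1 : M < `|M| + 1 by rewrite (le_lt_trans (ler_norm M)) // ltrDl.
  apply: (hM _ M1); exists y' => // j; rewrite /y'.
  case: ifP => [|_]; first exact: yO.
  by case: (Omega_ok j) => -[z Oz] _ _; exact: xgetPex (ex_intro _ z Oz).
exists (\sum_i s2val (bnd i)).
  by apply: sumr_ge0 => i _; case: (bnd i).
move=> i y yO; rewrite (bigD1 i) //=.
apply: (@le_trans _ _ (s2val (bnd i))); first by case: (bnd i) => K /= _; exact.
by rewrite lerDl; apply: sumr_ge0 => j _; case: (bnd j).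
Qed.

Definition feasible (x : 'cV[R]_(mtot GI)) :=
  forall i j, j \in tNI GI i -> Omega j (est GI x i j).

Lemma feasible_gossip x p q i j : feasible x -> j \in tNI GI i ->
  Omega j (est GI (Wm GI R p q *m x) i j).
Proof.
move=> xF ij; rewrite est_Wm //; case: ifP => [/andP[/andP[pj qj] _]|_].
  by apply: convex_midpoint; [case: (Omega_ok j)|exact: xF|exact: xF].
exact: xF.
Qed.

Lemma gradient_point_feasible x c i : feasible x ->
  in_Omega GI Omega i (gradient_point c x i).
Proof.
move=> xF j ij; rewrite /gradient_point; case: eqP => [->|_].
  exact/xF/tNI_refl.
exact: feasible_gossip.
Qed.

Lemma feasible_step c al x : feasible x -> feasible (step Omega g c al x).
Proof.
move=> xF i j ij; rewrite est_step //; case: eqP => [->|_].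
  rewrite /next_action; case: ifP => _; last exact/xF/tNI_refl.
  by case: (Omega_ok i) => O0 cO _; apply: (proj_closest _ O0 cO).1.
exact: feasible_gossip.
Qed.

Lemma feasible_traj x0 a k : feasible x0 -> feasible (traj GI Omega g a x0 k).
Proof. by move=> xF; elim: k => //= k; exact: feasible_step. Qed.

Variable K : R.
Hypothesis K_ge0 : 0 <= K.
Hypothesis g_le : forall i y, in_Omega GI Omega i y -> `|g i y| <= K.

Lemma next_action_move c al x l : feasible x ->
  (next_action Omega g c al x l - est GI x l l) ^+ 2
    <= if updated c l then 4 * K ^+ 2 * al l ^+ 2 else 0.
Proof.
move=> xF; rewrite /next_action /updated; case: ifP => _; last first.
  by rewrite subrr expr0n.
rewrite -real_normK ?num_real //.
have -> : 4 * K ^+ 2 * al l ^+ 2 = (2 * `|al l| * K) ^+ 2.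
  by rewrite !exprMn real_normK ?num_real //; ring.
rewrite ler_pXn2r ?nnegrE ?mulr_ge0 //.
apply: le_trans (proj_move _ _ _) _; first by case: (Omega_ok l).
  exact/xF/tNI_refl.
rewrite normrM -mulrA ler_wpM2l // ler_wpM2l //.
by apply: g_le; exact: gradient_point_feasible.
Qed.

Definition gap (x : 'cV[R]_(mtot GI)) (l i : 'I_N) : R := est GI x i l - est GI x l l.

Lemma gap_owner x l : gap x l l = 0. Proof. exact: subrr. Qed.

Definition disagreement (x : 'cV[R]_(mtot GI)) : R :=
  \sum_l \sum_(i in tNI GI l) gap x l i ^+ 2.

Definition gossiped_disagreement (c : 'I_N * 'I_N) (x : 'cV[R]_(mtot GI)) : R :=
  \sum_l \sum_(i in tNI GI l)
     average_followers (tNI GI l) l c.1 c.2 (gap x l) i ^+ 2.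

Lemma disagreement_ge0 x : 0 <= disagreement x.
Proof. by apply: sumr_ge0 => l _; apply: sumr_ge0 => i _; exact: sqr_ge0. Qed.

(** Averaging commutes with subtracting the owner's value. *)
Lemma gossip_gap c x l i : i \in tNI GI l -> i != l ->
  est GI (Wm GI R c.1 c.2 *m x) i l - est GI x l l
    = average_followers (tNI GI l) l c.1 c.2 (gap x l) i.
Proof.
move=> il /negPf neq_il; rewrite est_Wm //; last by rewrite -tNI_sym.
rewrite /average_followers neq_il andbA -!(tNI_sym GI_simple l).
by case: ifP => // _; rewrite /gap; field.
Qed.

(** A new gap is the averaged gap minus the owner's move. Young's inequality with weight [e]
    separates the two, and each move is charged to at most [N] followers. *)
Lemma disagreement_step c al x (e : R) : 0 < e -> feasible x ->
  disagreement (step Omega g c al x)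
    <= (1 + e) * gossiped_disagreement c x
       + (1 + e^-1) * N%:R * (4 * K ^+ 2) * noise c al.
Proof.
move=> e0 xF; have e1 : 0 <= 1 + e^-1 by rewrite addr_ge0 // invr_ge0 ltW.
rewrite /disagreement /gossiped_disagreement /noise !mulr_sumr -big_split /=.
apply: ler_sum => l _.
set nl := (if _ then _ else _).
have nl0 : 0 <= 4 * K ^+ 2 * nl.
  by rewrite mulr_ge0 ?mulr_ge0 ?sqr_ge0 // /nl; case: ifP => // _; exact: sqr_ge0.
have moveE : (next_action Omega g c al x l - est GI x l l) ^+ 2 <= 4 * K ^+ 2 * nl.
  by apply: le_trans (next_action_move _ _ _ xF) _; rewrite /nl; case: ifP => _;
    rewrite ?mulr0.
apply: (@le_trans _ _ (\sum_(i in tNI GI l)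
   ((1 + e) * average_followers (tNI GI l) l c.1 c.2 (gap x l) i ^+ 2
    + (1 + e^-1) * (4 * K ^+ 2 * nl)))).
  apply: ler_sum => i il.
  have li : l \in tNI GI i by rewrite tNI_sym.
  rewrite [X in X ^+ 2 <= _]/gap !est_step // ?tNI_refl // eqxx.
  have [->|neq_il] := eqVneq l i.
    rewrite subrr expr0n /=; apply: addr_ge0; apply: mulr_ge0 => //.
      by rewrite addr_ge0 // ltW.
    exact: sqr_ge0.
  rewrite /=.
  have -> : est GI (Wm GI R c.1 c.2 *m x) i l - next_action Omega g c al x l
     = average_followers (tNI GI l) l c.1 c.2 (gap x l) i
       - (next_action Omega g c al x l - est GI x l l).
    by rewrite -gossip_gap 1?eq_sym //; ring.
  apply: le_trans (sqr_sub_le _ _ e0) _.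
  by rewrite lerD2l ler_wpM2l.
rewrite big_split /= -mulr_sumr lerD2l sumr_const -[leLHS]mulr_natl.
have -> : (1 + e^-1) * N%:R * (4 * K ^+ 2) * nl
   = N%:R * ((1 + e^-1) * (4 * K ^+ 2 * nl)) by ring.
rewrite ler_wpM2r ?(mulr_ge0 e1 nl0) // ler_nat.
by rewrite -[X in (_ <= X)%N]card_ord max_card.
Qed.

(** Grouped by owner, the left side measures deviations from the mean of the copies, the right side
    deviations from the owner's value; the mean is optimal. *)
Lemma enorm_consensus_le x :
  enorm GI (x - Hm GI R *m Hbar GI R *m x) ^+ 2 <= disagreement x.
Proof.
rewrite /enorm sqr_sqrtr; last by apply: sumr_ge0 => a _; exact: sqr_ge0.
rewrite sum_sq_est //.
rewrite (exchange_big_dep xpredT) //=; apply: ler_sum => l _.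
rewrite (eq_bigl (fun i => i \in tNI GI l)); last by move=> i; rewrite tNI_sym.
under eq_bigr => i il do rewrite estB est_HHbar ?(tNI_sym GI_simple i l) //.
exact: variance_le.
Qed.

End Descent.

(** * Summability from a nonnegative supermartingale *)

Section Supermartingale.
Variables (R : realType) (d : measure_display) (T : measurableType d).
Variables (P : probability T R) (X : finType) (sel : nat -> T -> X) (pr : X -> R).

Definition cylinder (n : nat) (a : nat -> X) : set T :=
  [set w | forall k, (k < n)%N -> sel k w = a k].

Hypothesis sel_measurable : forall k a, measurable (sel k @^-1` [set a]).
Hypothesis pr_ge0 : forall c, 0 <= pr c.
Hypothesis sel_law : forall n a, P (cylinder n a) = (\prod_(k < n) pr (a k))%:E.

(** Adaptedness, phrased on sequences of draws in place of a filtration. *)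
Definition depends_on_prefix (S : Type) (n : nat) (F : (nat -> X) -> S) :=
  forall a b, (forall k, (k < n)%N -> a k = b k) -> F a = F b.

Lemma cylinderS n a : cylinder n.+1 a = cylinder n a `&` sel n @^-1` [set a n].
Proof.
apply/seteqP; split => [w h|w [h hn] k].
  by split => [k kn|]; apply: h => //; exact: ltnW.
by rewrite ltnS leq_eqVlt => /orP[/eqP ->//|]; exact: h.
Qed.

Lemma cylinder_measurable n a : measurable (cylinder n a).
Proof.
elim: n => [|n IH]; last by rewrite cylinderS; apply: measurableI.
by rewrite (_ : cylinder 0 a = setT) //; apply/seteqP; split.
Qed.

Lemma integral_sum_indic (I : finType) (B : I -> set T) (c : I -> R) :
  (forall i, measurable (B i)) -> (forall i, 0 <= c i) ->
  (\int[P]_w (\sum_i c i * \1_(B i) w)%:E = \sum_i (c i)%:E * P (B i))%E.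
Proof.
move=> mB c0.
under eq_integral do rewrite -sumEFin.
rewrite ge0_integral_sum //; last 2 first.
- by move=> i; apply/measurable_EFinP; apply: measurable_funM => //;
    exact: measurable_indic.
- by move=> i w _; rewrite lee_fin mulr_ge0.
apply: eq_bigr => i _.
under eq_integral do rewrite EFinM.
rewrite ge0_integralZl_EFin //.
- by rewrite integral_indic // setIT.
- by apply/measurable_EFinP; exact: measurable_indic.
Qed.

Lemma measurable_sum_indic (I : finType) (B : I -> set T) (c : I -> R) :
  (forall i, measurable (B i)) ->
  measurable_fun setT (fun w => (\sum_i c i * \1_(B i) w)%:E).
Proof.
move=> mB; apply/measurable_EFinP; apply: measurable_sum => i.
by apply: measurable_funM => //; exact: measurable_indic.
Qed.

Variable x0 : X.

Definition extend (n : nat) (f : {ffun 'I_n -> X}) (k : nat) : X :=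
  if insub k is Some i then f i else x0.

Lemma extend_lt n (f : {ffun 'I_n -> X}) k (kn : (k < n)%N) :
  extend f k = f (Ordinal kn).
Proof. by rewrite /extend insubT. Qed.

Definition set_at (a : nat -> X) (n : nat) (c : X) (k : nat) : X :=
  if k == n then c else a k.

(** Exactly one cylinder of length [n] contains [w], so an adapted quantity is a simple function and
    its integral is a finite sum. *)
Lemma sum_extend n (F : (nat -> X) -> R) w : depends_on_prefix n F ->
  F (sel^~ w) = \sum_(f : {ffun 'I_n -> X}) F (extend f) * \1_(cylinder n (extend f)) w.
Proof.
move=> Fn; pose f0 := [ffun k : 'I_n => sel k w].
have f0E k : (k < n)%N -> extend f0 k = sel k w.
  by move=> kn; rewrite (extend_lt f0 kn) ffunE.
rewrite (bigD1 f0) //= big1 ?addr0.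
  rewrite indicE mem_set ?mulr1; last by move=> k kn; rewrite f0E.
  by apply: Fn => k kn; rewrite f0E.
move=> f ff0; rewrite indicE memNset ?mulr0 // => h.
case/negP: ff0; apply/eqP/ffunP => k; rewrite ffunE h //.
by rewrite (extend_lt f (ltn_ord k)); congr (f _); exact: val_inj.
Qed.

(** The same decomposition with the last draw split off, so that the cylinder probability
    factors. *)
Lemma sum_extend_set_at n (F : (nat -> X) -> R) w : depends_on_prefix n.+1 F ->
  F (sel^~ w) = \sum_(fc : {ffun 'I_n -> X} * X)
     F (set_at (extend fc.1) n fc.2)
       * \1_(cylinder n.+1 (set_at (extend fc.1) n fc.2)) w.
Proof.
move=> Fn; pose f0 := [ffun k : 'I_n => sel k w].
have f0E k : (k < n.+1)%N -> set_at (extend f0) n (sel n w) k = sel k w.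
  rewrite /set_at ltnS leq_eqVlt; case: eqP => [->//|_ /= kn].
  by rewrite (extend_lt f0 kn) ffunE.
rewrite (bigD1 (f0, sel n w)) //= big1 ?addr0.
  rewrite indicE mem_set ?mulr1; last by move=> k kn; rewrite f0E.
  by apply: Fn => k kn; rewrite f0E.
move=> [f c] ff0; rewrite indicE memNset ?mulr0 // => h.
case/negP: ff0; apply/eqP; congr pair; last first.
  by rewrite h //= /set_at eqxx.
apply/ffunP => k; rewrite ffunE h //=; last by rewrite ltnS ltnW.
rewrite /set_at (ltn_eqF (ltn_ord k)).
by rewrite (extend_lt f (ltn_ord k)); congr (f _); exact: val_inj.
Qed.

Lemma measurable_prefix n (F : (nat -> X) -> R) : depends_on_prefix n F ->
  measurable_fun setT (fun w => (F (sel^~ w))%:E).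
Proof.
move=> Fn; under eq_fun do rewrite (sum_extend _ Fn).
apply: measurable_sum_indic => f; exact: cylinder_measurable.
Qed.

Lemma cylinder_set_at n a c :
  P (cylinder n.+1 (set_at a n c)) = (P (cylinder n a) * (pr c)%:E)%E.
Proof.
rewrite !sel_law big_ord_recr /= /set_at eqxx EFinM.
by under eq_bigr => k _ do rewrite (ltn_eqF (ltn_ord k)).
Qed.

Variable M : nat -> (nat -> X) -> R.
Hypothesis M_prefix : forall n, depends_on_prefix n (M n).
Hypothesis M_ge0 : forall n a, 0 <= M n a.
Hypothesis M_super : forall n a, \sum_c pr c * M n.+1 (set_at a n c) <= M n a.

(** Conditioning on the past becomes a sum over cylinders of length [n]; on each of them [M_super]
    averages the next draw. *)
Lemma integral_supermartingale n :
  (\int[P]_w (M n (sel^~ w))%:E <= (M 0 (fun=> x0))%:E)%E.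
Proof.
elim: n => [|n IH].
  (* [M 0] reads no draw, hence it is constant. *)
  under eq_integral => w _ do rewrite (M_prefix (b := fun=> x0)) //.
  rewrite integral_cst // -[leRHS]mule1 lee_wpmul2l ?lee_fin //; exact: probability_le1.
apply: le_trans IH.
under eq_integral do rewrite (sum_extend_set_at _ (@M_prefix n.+1)).
under [leRHS]eq_integral do rewrite (sum_extend _ (@M_prefix n)).
rewrite !integral_sum_indic //; try (by move=> *; exact: cylinder_measurable).
rewrite -(pair_bigA _ (fun f c => (M n.+1 (set_at (extend f) n c))%:E *
   P (cylinder n.+1 (set_at (extend f) n c))))%E /=.
apply: lee_sum => f _.
under eq_bigr do rewrite cylinder_set_at muleCA -EFinM mulrC.
rewrite -ge0_sume_distrr; last by move=> c _; rewrite lee_fin mulr_ge0.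
by rewrite muleC lee_wpmul2r ?measure_ge0 // sumEFin lee_fin M_super.
Qed.

Variables (V : nat -> (nat -> X) -> R) (rate : R).
Hypothesis rate_gt0 : 0 < rate.
Hypothesis V_prefix : forall n, depends_on_prefix n (V n).
Hypothesis V_ge0 : forall n a, 0 <= V n a.
Hypothesis V_le_M : forall n a, rate * \sum_(k < n) V k a <= M n a.

(** The expected partial sums are bounded by the initial value of [M] over [rate]. By monotone
    convergence the series is integrable, hence finite almost everywhere. *)
Lemma ae_summable :
  {ae P, forall w, (\sum_(0 <= k <oo) (V k (sel^~ w))%:E < +oo)%E}.
Proof.
have mV k : measurable_fun setT (fun w => (V k (sel^~ w))%:E).
  exact: measurable_prefix (@V_prefix k).
have V0 k w : (0 <= (V k (sel^~ w))%:E)%E by rewrite lee_fin.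
have S0 w : (0 <= \sum_(0 <= k <oo) (V k (sel^~ w))%:E)%E.
  exact: nneseries_ge0.
have mS : measurable_fun setT (fun w => \sum_(0 <= k <oo) (V k (sel^~ w))%:E)%E.
  by apply: ge0_emeasurable_sum => // k w _ _.
have intS n : (\sum_(0 <= k < n) \int[P]_w (V k (sel^~ w))%:E
    <= (rate^-1 * M 0 (fun=> x0))%:E)%E.
  rewrite -ge0_integral_sum //.
  apply: (@le_trans _ _ (\int[P]_w (rate^-1%:E * (M n (sel^~ w))%:E))%E).
    apply: ge0_le_integral => //.
    - by move=> w _; apply: sume_ge0 => k _.
    - by apply: emeasurable_sum.
    - by apply: measurable_funeM; exact: measurable_prefix (@M_prefix n).
    - by move=> w _; rewrite sumEFin -EFinM lee_fin ler_pdivlMl // big_mkord.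
  rewrite ge0_integralZl_EFin //; last 3 first.
  - by move=> w _; rewrite lee_fin.
  - exact: measurable_prefix (@M_prefix n).
  - by rewrite invr_ge0 ltW.
  rewrite EFinM; apply: lee_wpmul2l; first by rewrite lee_fin invr_ge0 ltW.
  exact: integral_supermartingale.
have int : P.-integrable setT (fun w => \sum_(0 <= k <oo) (V k (sel^~ w))%:E)%E.
  apply/integrableP; split => //.
  under eq_integral => w _ do rewrite gee0_abs //.
  rewrite integral_nneseries //.
  apply: (@le_lt_trans _ _ (rate^-1 * M 0 (fun=> x0))%:E); last exact: ltry.
  apply: lime_le => //; last exact: nearW.
  by apply: is_cvg_nneseries => k _ _; apply: integral_ge0 => w _.
have := integrable_ae measurableT int; apply: filterS => w /(_ I).
by rewrite ge0_fin_numE.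
Qed.

End Supermartingale.

(** * Mean descent under a perturbation of bounded total size *)

Section PerturbedDescent.
Variables (R : realType) (d : measure_display) (T : measurableType d).
Variables (P : probability T R) (X : finType) (sel : nat -> T -> X) (pr : X -> R).
Hypothesis sel_measurable : forall k a, measurable (sel k @^-1` [set a]).
Hypothesis pr_ge0 : forall c, 0 <= pr c.
Hypothesis pr_le1 : \sum_c pr c <= 1.
Hypothesis sel_law :
  forall n a, P (cylinder sel n a) = (\prod_(k < n) pr (a k))%:E.
Variables (V b : nat -> (nat -> X) -> R) (G : nat -> (nat -> X) -> X -> R).
Variables (rate B : R).
Hypothesis rate_gt0 : 0 < rate.
Hypothesis V_ge0 : forall n a, 0 <= V n a.
Hypothesis V_prefix : forall n, depends_on_prefix n (V n).
Hypothesis b_prefix : forall n, depends_on_prefix n.+1 (b n).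
Hypothesis b_sum_le : forall n a, \sum_(k < n) b k a <= B.
Hypothesis V_step : forall n a c,
  V n.+1 (set_at a n c) <= G n a c + b n (set_at a n c).
Hypothesis G_mean : forall n a, \sum_c pr c * G n a c <= (1 - rate) * V n a.

(* Adding the unused part of the perturbation budget keeps the process
   nonnegative. *)
Let M n a : R := V n a + rate * (\sum_(k < n) V k a) + (B - \sum_(k < n) b k a).

Let sum_le_M n a : rate * \sum_(k < n) V k a <= M n a.
Proof. by rewrite /M -addrA addrCA lerDl addr_ge0 // subr_ge0. Qed.

Let M_ge0 n a : 0 <= M n a.
Proof.
apply: le_trans (sum_le_M n a).
by apply: mulr_ge0; [exact: ltW|exact: sumr_ge0].
Qed.

Let M_prefix n : depends_on_prefix n (M n).
Proof.
move=> a a' aa'.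
have sumV : \sum_(k < n) V k a = \sum_(k < n) V k a'.
  apply: eq_bigr => k _; apply: V_prefix => t tk.
  by apply: aa'; exact: ltn_trans tk _.
have sumb : \sum_(k < n) b k a = \sum_(k < n) b k a'.
  apply: eq_bigr => k _; apply: b_prefix => t tk.
  by apply: aa'; exact: leq_trans tk _.
by rewrite /M (V_prefix aa') sumV sumb.
Qed.

(** The mean drop [rate * V n a] pays for the new term of the accumulated sum, and the perturbation
    is taken out of the budget. *)
Let M_super n a : \sum_c pr c * M n.+1 (set_at a n c) <= M n a.
Proof.
pose r := rate * (\sum_(k < n) V k a) + (B - \sum_(k < n) b k a).
have r_ge0 : 0 <= r.
  by rewrite addr_ge0 ?subr_ge0 // mulr_ge0 ?sumr_ge0 // ltW.
have stepM c : M n.+1 (set_at a n c) <= G n a c + (rate * V n a + r).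
  have at_lt k : (k < n)%N -> set_at a n c k = a k.
    by move=> kn; rewrite /set_at ltn_eqF.
  have Vk k : (k <= n)%N -> V k (set_at a n c) = V k a.
    move=> kn; apply: V_prefix => t tk.
    by apply: at_lt; exact: leq_trans tk kn.
  have bk k : (k < n)%N -> b k (set_at a n c) = b k a.
    move=> kn; apply: b_prefix => t tk.
    by apply: at_lt; exact: leq_trans tk kn.
  rewrite /M !big_ord_recr /= (Vk n) //.
  rewrite (eq_bigr (fun k : 'I_n => V k a)) => [|k _]; last exact/Vk/ltnW.
  rewrite [X in _ - (X + _)](eq_bigr (fun k : 'I_n => b k a))
    => [|k _]; last exact/bk.
  have := V_step n a c; rewrite /r; lra.
apply: (@le_trans _ _ (\sum_c pr c * (G n a c + (rate * V n a + r)))).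
  by apply: ler_sum => c _; rewrite ler_wpM2l.
(* Nonnegativity of the part independent of the draw lets a total mass of at most one suffice. *)
have t_ge0 : 0 <= rate * V n a + r.
  by rewrite addr_ge0 // mulr_ge0 // ltW.
under eq_bigr do rewrite mulrDr.
rewrite big_split /= -mulr_suml.
have h := ler_wpM2r t_ge0 pr_le1.
have := G_mean n a; move: h; rewrite /M -addrA -/r; lra.
Qed.

Lemma ae_summable_descent (c0 : X) :
  {ae P, forall w, (\sum_(0 <= k <oo) (V k (sel^~ w))%:E < +oo)%E}.
Proof.
exact: (ae_summable sel_measurable pr_ge0 sel_law c0
  M_prefix M_ge0 M_super rate_gt0 V_prefix V_ge0 sum_le_M).
Qed.

End PerturbedDescent.

(** * Dependence of the algorithm on the draws *)

Section Trajectories.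
Variables (R : realType) (N : nat) (GI : rel 'I_N).
Variables (Omega : 'I_N -> set R) (g : 'I_N -> ('I_N -> R) -> R).
Variable x0 : 'cV[R]_(mtot GI).

(** The prefix has length [k.+1] because [nu] counts the draw at time [k] as well, whereas the state
    at time [k] depends on earlier draws only. *)
Lemma alpha_prefix k : depends_on_prefix k.+1 (fun a : nat -> 'I_N * 'I_N => alpha R a k).
Proof.
move=> a b ab; apply/funext => i; rewrite /alpha /nu; congr (_%:R^-1).
by apply: eq_bigr => t _; rewrite ab.
Qed.

Lemma alpha_ge0 (a : nat -> 'I_N * 'I_N) k i : 0 <= alpha R a k i.
Proof. by rewrite invr_ge0. Qed.

(** This transfers the square summability assumed for each player to the maximal step size. *)
Lemma sqr_alpha_max_le (a : nat -> 'I_N * 'I_N) k :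
  alpha_max R a k ^+ 2 <= \sum_i alpha R a k i ^+ 2.
Proof.
rewrite /alpha_max.
apply: (big_ind (fun t : R => t ^+ 2 <= \sum_i alpha R a k i ^+ 2)).
- by rewrite expr0n /= sumr_ge0 // => i _; exact: sqr_ge0.
- by move=> s t sS tS; rewrite /Num.max; case: ifP.
- move=> i _; rewrite [leRHS](bigD1 i) //= lerDl sumr_ge0 // => j _.
  exact: sqr_ge0.
Qed.

Lemma traj_prefix k : depends_on_prefix k (fun a => traj GI Omega g a x0 k).
Proof.
elim: k => [//|k IH] a b ab /=.
rewrite (IH a b); last by move=> t tk; apply: ab; exact: ltnW.
by rewrite (alpha_prefix ab) ab.
Qed.

Lemma noise_prefix k :
  depends_on_prefix k.+1 (fun a : nat -> 'I_N * 'I_N => noise (a k) (alpha R a k)).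
Proof. by move=> a a' aa'; rewrite (alpha_prefix aa') aa'. Qed.

Lemma disagreement_step_set_at (K e : R) k a c :
  simple_graph GI ->
  (forall i, [/\ Omega i !=set0, compact (Omega i) & convex_set (Omega i)]) ->
  0 <= K -> (forall i y, in_Omega GI Omega i y -> `|g i y| <= K) ->
  0 < e -> feasible Omega x0 ->
  disagreement (traj GI Omega g (set_at a k c) x0 k.+1)
    <= (1 + e) * gossiped_disagreement c (traj GI Omega g a x0 k)
       + (1 + e^-1) * N%:R * (4 * K ^+ 2)
         * noise (set_at a k c k) (alpha R (set_at a k c) k).
Proof.
move=> GI_simple Omega_ok K0 gK e0 x0F.
have xE : traj GI Omega g (set_at a k c) x0 k = traj GI Omega g a x0 k.
  by apply: traj_prefix => t tk; rewrite /set_at ltn_eqF.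
have an : set_at a k c k = c by rewrite /set_at eqxx.
rewrite [traj _ _ _ _ _ k.+1]/= xE an.
by apply: disagreement_step => //; exact: feasible_traj.
Qed.

End Trajectories.

(** After exchanging the sums, the contraction applies to each owner separately, with the same
    rate. *)
Lemma gossiped_disagreement_mean (R : realType) (N : nat) (GI GC Gm : rel 'I_N)
    (x : 'cV[R]_(mtot GI)) :
  simple_graph GI -> max_triangle_free_spanning_subgraph Gm GI -> subgraph Gm GC ->
  \sum_c pdist R GC c * gossiped_disagreement c x
    <= (1 - gossip_rate N R) * disagreement x.
Proof.
move=> GI_simple Gm_max Gm_GC.
under eq_bigr do rewrite /gossiped_disagreement mulr_sumr.
rewrite exchange_big /disagreement mulr_sumr; apply: ler_sum => l _.
exact: (followers_contraction GI_simple Gm_max Gm_GC (gap_owner x l)).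
Qed.

Unset Implicit Arguments.

Theorem theorem1 (R : realType) (N : nat) (GI GC : rel 'I_N)
  (Omega : 'I_N -> set R) (J g : 'I_N -> ('I_N -> R) -> R)
  (x0 : 'cV[R]_(mtot GI))
  (d : measure_display) (T : measurableType d) (P : probability T R)
  (sel : nat -> T -> 'I_N * 'I_N) :
  (2 <= N)%N ->
  simple_graph GI -> connected_graph GI -> ~ complete_graph GI ->
  simple_graph GC -> subgraph GC GI ->
  (exists Gm, max_triangle_free_spanning_subgraph Gm GI /\ subgraph Gm GC) ->
  (forall i, [/\ Omega i !=set0, compact (Omega i) & convex_set (Omega i)]) ->
  (forall i, local GI i (J i)) ->
  (forall i, local GI i (g i)) ->
  (forall i, cont_on (in_Omega GI Omega i) (J i)) ->
  (forall i, cont_on (in_Omega GI Omega i) (g i)) ->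
  (forall i, is_partial_grad GI Omega i (J i) (g i)) ->
  (forall i y, in_Omega GI Omega i y ->
     convex_function (Omega i) (fun t => J i (upd y i t))) ->
  (forall i j, j \in tNI GI i -> Omega j (est GI x0 i j)) ->
  (forall k a, measurable (sel k @^-1` [set a])) ->
  (forall n (a : nat -> 'I_N * 'I_N),
     P [set w | forall k, (k < n)%N -> sel k w = a k]
       = (\prod_(k < n) pdist R GC (a k))%:E) ->
  {ae P, forall w, forall i,
     (\sum_(0 <= k <oo) ((alpha R (sel^~ w) k i) ^+ 2)%:E < +oo)%E /\
     (\sum_(0 <= k <oo) (alpha R (sel^~ w) k i)%:E = +oo)%E} ->
  {ae P, forall w,
     (\sum_(0 <= k <oo)
        (alpha_max R (sel^~ w) k
         * enorm GI (traj GI Omega g (sel^~ w) x0 k - Zt GI Omega g (sel^~ w) x0 k))%:E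
      < +oo)%E} /\
  {ae P, forall w,
     (\sum_(0 <= k <oo)
        ((enorm GI (traj GI Omega g (sel^~ w) x0 k - Zt GI Omega g (sel^~ w) x0 k)) ^+ 2)%:E
      < +oo)%E}.
Proof.
move=> N2 GIs _ _ _ _ [Gm [Gmmax GmGC]] Ok _ gloc _ gcont _ _ x0F selm law al2.
have [K K0 gK] := gradient_bounded Ok gloc gcont.
have N0 : (0 < N)%N by apply: ltnW.
pose o := Ordinal N0.
have e_gt0 : 0 < gossip_rate N R.
  by rewrite invr_gt0 mulr_gt0 // exprn_gt0 // ltr0n.
(* With Young's weight equal to the contraction rate, the factor [(1 + e) * (1 - e)] is
   [1 - e ^+ 2], so descent survives at rate [e ^+ 2]. *)
set e := gossip_rate N R; pose C : R := (1 + e^-1) * N%:R * (4 * K ^+ 2).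
have C0 : 0 <= C.
  apply: mulr_ge0; last by rewrite mulr_ge0 ?sqr_ge0.
  by rewrite mulr_ge0 // addr_ge0 // invr_ge0 ltW.
have sumV : {ae P, forall w,
    (\sum_(0 <= k <oo) (disagreement (traj GI Omega g (sel^~ w) x0 k))%:E < +oo)%E}.
  (* The budget [C * (2 * N%:R)] comes from [sum_noise_le]; the pair [(o, o)] is an arbitrary letter
     padding finite words. *)
  apply: (@ae_summable_descent _ _ _ P _ sel (pdist R GC) selm (@pdist_ge0 N R GC)
    (pdist_sum_le1 R GC) law
    (fun k a => disagreement (traj GI Omega g a x0 k))
    (fun k a => C * noise (a k) (alpha R a k))
    (fun k a c => (1 + e) * gossiped_disagreement c (traj GI Omega g a x0 k))
    (e ^+ 2) (C * (2 * N%:R)) (exprn_gt0 2 e_gt0) _ _ _ _ _ _ (o, o)).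
  - by move=> n a; exact: disagreement_ge0.
  - by move=> n a a' aa'; rewrite (traj_prefix Omega g x0 aa').
  - by move=> n a a' aa'; rewrite (noise_prefix R aa').
  - by move=> n a; rewrite -mulr_sumr ler_wpM2l // sum_noise_le.
  - by move=> n a c; exact: disagreement_step_set_at.
  - move=> n a; under eq_bigr do rewrite mulrCA.
    rewrite -mulr_sumr (_ : 1 - e ^+ 2 = (1 + e) * (1 - e)); last by ring.
    rewrite -mulrA; apply: ler_wpM2l; first by rewrite addr_ge0 // ltW.
    exact: (gossiped_disagreement_mean _ GIs Gmmax GmGC).
have sum_sq : {ae P, forall w, (\sum_(0 <= k <oo)
    ((enorm GI (traj GI Omega g (sel^~ w) x0 k - Zt GI Omega g (sel^~ w) x0 k)) ^+ 2)%:E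
    < +oo)%E}.
  apply: filterS sumV => w; apply: le_lt_trans; apply: lee_nneseries => k.
    by rewrite lee_fin sqr_ge0.
  by rewrite lee_fin enorm_consensus_le.
split => //; apply: filterS2 al2 sum_sq => w aw ew.
pose u k := enorm GI (traj GI Omega g (sel^~ w) x0 k - Zt GI Omega g (sel^~ w) x0 k).
(* The product is dominated by the squared step sizes of all players plus the squared error, and
   both series converge. *)
apply: (@le_lt_trans _ _ (\sum_(0 <= k <oo)
    (\sum_i (alpha R (sel^~ w) k i ^+ 2)%:E + (u k ^+ 2)%:E))%E).
  apply: lee_nneseries => k.
    move=> _; rewrite lee_fin mulr_ge0 ?sqrtr_ge0 //.
    by apply: le_trans (le_bigmax _ _ o); exact: alpha_ge0.
  move=> _; rewrite sumEFin -EFinD lee_fin.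
  have := sqr_alpha_max_le R (sel^~ w) k.
  rewrite -/(u k); set A := alpha_max _ _ _; set B := \sum_i _.
  by have := sqr_ge0 (A - u k); nra.
rewrite nneseriesD; last 2 first.
- by move=> k _ _; apply: sume_ge0 => i _; rewrite lee_fin sqr_ge0.
- by move=> k _ _; rewrite lee_fin sqr_ge0.
apply: lte_add_pinfty => //.
rewrite nneseries_sum; last by move=> *; rewrite lee_fin sqr_ge0.
by apply: lte_sum_pinfty => i _; case: (aw i).
Qed.
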